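(* For every constant $C_0\ge1$ there is a constant $C\ge 1$ depending only on $C_0$ such that the following holds. Let $a\ge b>0$, and let $S\subset\mathbb R^3$ be the surface obtained by revolving either the ellipse $\frac{x^2}{a^2}+\frac{y^2}{b^2}=1$ or the hyperbola $\frac{x^2}{a^2}-\frac{y^2}{b^2}=1$ about the $x$-axis. Let $B\subset\mathbb R^3$ be a ball centered at one of the foci of $S$, with radius $R$ satisfying $$C_0^{-1}\frac{b^2}{a}\le R\le C_0\,a .$$ Let $\delta>0$ and let $P_\delta\subset\mathbb R^3$ be any $\delta$-thickened plane. Then $$\sigma(S\cap B\cap P_\delta)\le C\,R\,\delta,$$ where $\sigma$ denotes surface measure on $S$.
   Context: The foci of $S$ are the points $(\pm c,0,0)$, where $c=\sqrt{a^2-b^2}$ for the ellipse and $c=\sqrt{a^2+b^2}$ for the hyperbola. A $\delta$-thickened plane is the closed region of $\mathbb R^3$ between two parallel planes at distance $\delta$ from each other. *)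

(* Defs.v *)
From HB Require Import structures.
From mathcomp Require Import all_boot all_order all_algebra.
From mathcomp Require Import ring lra.
From mathcomp Require Import all_classical all_reals all_analysis.

Set Implicit Arguments.
Unset Strict Implicit.
Unset Printing Implicit Defensive.

Import Order.TTheory GRing.Theory Num.Theory.
Import numFieldNormedType.Exports.

Local Open Scope classical_set_scope.
Local Open Scope ring_scope.

Section EuclideanSpace.
Variable R : realType.
Implicit Types u v n : 'rV[R]_3.

Definition vec3 (x y z : R) : 'rV[R]_3 := \row_i [:: x; y; z]`_i.

Definition dot u v : R := \sum_i u 0 i * v 0 i.

(* The library norm on 'rV[R]_3 is the sup norm, hence a separate definition. *)
Definition enorm u : R := Num.sqrt (dot u u).

Definition closed_eball (c : 'rV[R]_3) (r : R) : set 'rV[R]_3 :=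
  [set p | enorm (p - c) <= r].

(* For a unit vector n, the planes n . p = t and n . p = t + delta are parallel
   at distance delta, and every pair of such planes is of this form. *)
Definition thickened_plane (delta : R) (P : set 'rV[R]_3) : Prop :=
  exists n (t : R),
    enorm n = 1 /\ P = [set p | t <= dot n p <= t + delta].

(* Area, with multiplicity, of the part lying in A of the surface parametrized
   by Phi on D.  The density is the area element sqrt (E G - F^2) of the first
   fundamental form, which equals |Phi_u x Phi_v|. *)
Section ParametrizedArea.
Variable Phi : R -> R -> 'rV[R]_3.

Definition partial1 (u v : R) : 'rV[R]_3 :=
  \row_i derive1 (fun s : R => Phi s v 0 i) u.

Definition partial2 (u v : R) : 'rV[R]_3 :=
  \row_i derive1 (fun s : R => Phi u s 0 i) v.

Definition area_element (u v : R) : R :=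
  Num.sqrt (dot (partial1 u v) (partial1 u v) * dot (partial2 u v) (partial2 u v)
            - dot (partial1 u v) (partial2 u v) ^+ 2).

Definition parametrized_area (D : set (R * R)) (A : set 'rV[R]_3) : \bar R :=
  (\int[(@lebesgue_measure R) \x (@lebesgue_measure R)]_(w in D)
     (\1_A (Phi w.1 w.2) * area_element w.1 w.2)%:E)%E.

End ParametrizedArea.
End EuclideanSpace.

Variant conic := Ellipse | Hyperbola.

Section QuadricOfRevolution.
Variable R : realType.
Variables (k : conic) (a b : R).

Definition conic_curve : set (R * R) :=
  match k with
  | Ellipse => [set q | q.1 ^+ 2 / a ^+ 2 + q.2 ^+ 2 / b ^+ 2 = 1]
  | Hyperbola => [set q | q.1 ^+ 2 / a ^+ 2 - q.2 ^+ 2 / b ^+ 2 = 1]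
  end.

(* The point (x, r) of the half-plane through the x-axis, rotated by theta. *)
Definition rotate (x r theta : R) : 'rV[R]_3 :=
  vec3 x (r * cos theta) (r * sin theta).

Definition quadric : set 'rV[R]_3 :=
  [set p | exists q theta, conic_curve q /\ p = rotate q.1 q.2 theta].

Definition focal_distance : R :=
  match k with
  | Ellipse => Num.sqrt (a ^+ 2 - b ^+ 2)
  | Hyperbola => Num.sqrt (a ^+ 2 + b ^+ 2)
  end.

Definition foci : set 'rV[R]_3 :=
  [set vec3 focal_distance 0 0; vec3 (- focal_distance) 0 0].

Definition profile_domain : set R :=
  match k with
  | Ellipse => [set x | `|x| <= a]
  | Hyperbola => [set x | a <= `|x|]
  end.

Definition profile (x : R) : R :=
  match k with
  | Ellipse => b * Num.sqrt (1 - x ^+ 2 / a ^+ 2)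
  | Hyperbola => b * Num.sqrt (x ^+ 2 / a ^+ 2 - 1)
  end.

Definition quadric_param (x theta : R) : 'rV[R]_3 := rotate x (profile x) theta.

Definition param_domain : set (R * R) := profile_domain `*` `[0, 2 * pi[.

(* Surface measure on the quadric.  The parametrization covers the quadric and
   is injective away from the poles x = a, x = - a (see quadric_param_image and
   quadric_param_inj below); the lines |x| = a of the parameter plane, where the
   profile is not differentiable, are negligible. *)
Definition surface_measure (A : set 'rV[R]_3) : \bar R :=
  parametrized_area quadric_param param_domain A.

End QuadricOfRevolution.

Section Parametrization.
Variables (R : realType) (k : conic) (a b : R).
Hypotheses (a0 : 0 < a) (b0 : 0 < b).

Lemma polar_coordinates (y z r : R) : 0 <= r -> y ^+ 2 + z ^+ 2 = r ^+ 2 ->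
  exists2 t, 0 <= t < 2 * pi & y = r * cos t /\ z = r * sin t.
Proof.
move=> r0; have pi0 := pi_gt0 R.
have [->|rN0] := eqVneq r 0 => yz.
  exists 0; first by apply/andP; split; lra.
  have /eqP : y ^+ 2 = 0 by nra.
  have /eqP : z ^+ 2 = 0 by nra.
  by rewrite !sqrf_eq0 => /eqP -> /eqP ->; rewrite !mul0r.
have rp : 0 < r by rewrite lt_neqAle eq_sym rN0.
have yr : -1 <= y / r <= 1.
  by rewrite ler_pdivlMr// ler_pdivrMr//; apply/andP; split; nra.
have sE : Num.sqrt (1 - (y / r) ^+ 2) = `|z| / r.
  have -> : 1 - (y / r) ^+ 2 = (z / r) ^+ 2.
    rewrite !expr_div_n (_ : z ^+ 2 = r ^+ 2 - y ^+ 2); first by field.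
    by rewrite -yz addrC addKr.
  by rewrite sqrtr_sqr normrM normfV (gtr0_norm rp).
have A0 := acos_ge0 yr; have Api := acos_lepi yr.
have cA := acosK yr; have sA := sin_acos yr; rewrite sE in sA.
have [z0|z0] := leP 0 z.
  exists (acos (y / r)); first by apply/andP; split; lra.
  by rewrite cA sA (ger0_norm z0) !(mulrC r) !divfK.
exists (- acos (y / r) + pi *+ 2); last first.
  rewrite cosD2pi sinD2pi cosN sinN cA sA (ltr0_norm z0).
  by rewrite mulNr opprK !(mulrC r) !divfK.
suff : 0 < acos (y / r) by move=> ?; apply/andP; split; lra.
rewrite lt_neqAle A0 andbT; apply/eqP => E; move: sA; rewrite -E sin0 => /eqP.
by rewrite eq_sym mulf_eq0 invr_eq0 normr_eq0 (negbTE rN0) orbF lt_eqF.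
Qed.

Lemma conic_curveP (x r : R) : conic_curve k a b (x, r) <->
  profile_domain k a x /\ r ^+ 2 = profile k a b x ^+ 2.
Proof.
have a2 : 0 < a ^+ 2 by rewrite exprn_gt0.
have b2 : 0 < b ^+ 2 by rewrite exprn_gt0.
have aN0 := lt0r_neq0 a0; have bN0 := lt0r_neq0 b0.
case: k => /=.
- have dom : (`|x| <= a) = (0 <= 1 - x ^+ 2 / a ^+ 2).
    rewrite subr_ge0 ler_pdivrMr// mul1r -(real_normK (num_real x)).
    by rewrite ler_pXn2r// nnegrE ltW.
  split=> [E|[]].
    have rE : r ^+ 2 = b ^+ 2 * (1 - x ^+ 2 / a ^+ 2) by rewrite -E; field; rewrite aN0 bN0.
    have d : 0 <= 1 - x ^+ 2 / a ^+ 2.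
      by rewrite -(pmulr_rge0 _ b2) -rE sqr_ge0.
    by rewrite dom exprMn sqr_sqrtr.
  rewrite dom => d; rewrite exprMn sqr_sqrtr// => ->.
  by field; rewrite aN0 bN0.
- have dom : (a <= `|x|) = (0 <= x ^+ 2 / a ^+ 2 - 1).
    rewrite subr_ge0 ler_pdivlMr// mul1r -(real_normK (num_real x)).
    by rewrite ler_pXn2r// nnegrE ltW.
  split=> [E|[]].
    have rE : r ^+ 2 = b ^+ 2 * (x ^+ 2 / a ^+ 2 - 1) by rewrite -E; field; rewrite aN0 bN0.
    have d : 0 <= x ^+ 2 / a ^+ 2 - 1.
      by rewrite -(pmulr_rge0 _ b2) -rE sqr_ge0.
    by rewrite dom exprMn sqr_sqrtr.
  rewrite dom => d; rewrite exprMn sqr_sqrtr// => ->.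
  by field; rewrite aN0 bN0.
Qed.

Lemma profile_ge0 (x : R) : 0 <= profile k a b x.
Proof. by case: k => /=; rewrite mulr_ge0 ?sqrtr_ge0 ?ltW. Qed.

Lemma quadric_param_image :
  quadric k a b =
  [set quadric_param k a b w.1 w.2 | w in param_domain k a].
Proof.
apply/seteqP; split=> [p [[x r] [t [/conic_curveP[xD rE] ->]]]|p [[x t]]] /=.
  have [||s s_itv [yE zE]] :=
      @polar_coordinates (r * cos t) (r * sin t) (profile k a b x).
  - exact: profile_ge0.
  - by rewrite !exprMn -mulrDr cos2Dsin2 mulr1.
  exists (x, s); first by split=> //=; rewrite in_itv.
  by rewrite /quadric_param /rotate /= yE zE.
move=> [/= xD _] <-; exists (x, profile k a b x), t; split=> //.
exact/conic_curveP.
Qed.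

Lemma quadric_param_inj (x x' t t' : R) :
  0 <= t < 2 * pi -> 0 <= t' < 2 * pi -> profile k a b x != 0 ->
  quadric_param k a b x t = quadric_param k a b x' t' -> x = x' /\ t = t'.
Proof.
have pi0 := pi_gt0 R.
move=> /andP[t0 t2] /andP[t'0 t'2] rN0 /matrixP E.
have := E 0 0; rewrite !mxE /= => xE; rewrite -{}xE in E *; split=> //.
have := E 0 1; rewrite !mxE /= => /(mulfI rN0) cE.
have := E 0 2%:R; rewrite !mxE /= => /(mulfI rN0) sE.
have : cos ((t - t') / 2 *+ 2) = 1.
  rewrite -mulr_natr divfK ?pnatr_eq0// cosB cE sE -!expr2.
  exact: cos2Dsin2.
rewrite cos_mulr2n mulr2n cos2sin2 => E2.
have /eqP : sin ((t - t') / 2) ^+ 2 = 0 by lra.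
rewrite sqrf_eq0 => /eqP s0; apply/eqP; rewrite -subr_eq0.
have [tt'|tt'|//] := ltgtP (t - t') 0.
- have : 0 < sin (- ((t - t') / 2)) by apply: sin_gt0_pi; apply/andP; split; lra.
  by rewrite sinN s0 oppr0 ltxx.
- have : 0 < sin ((t - t') / 2) by apply: sin_gt0_pi; apply/andP; split; lra.
  by rewrite s0 ltxx.
Qed.

End Parametrization.

(* Main.v *)
Require Import Defs.
From mathcomp Require Import all_boot all_order all_algebra.
From mathcomp Require Import ring lra.
From mathcomp Require Import all_classical all_reals all_analysis.
From mathcomp Require Import measurable_realfun.

Set Implicit Arguments.
Unset Strict Implicit.
Unset Printing Implicit Defensive.

Import Order.TTheory GRing.Theory Num.Theory.
Import numFieldNormedType.Exports.

Local Open Scope classical_set_scope.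
Local Open Scope ring_scope.

(* Let y = ||x| - a|.  The distance to a focus is |a - e x| (up to the sign of
   x), so the ball forces y <= rho, and there the area element is at most a
   constant times w = b sqrt (rho / a).  It remains to show that the region of
   the (x, theta)-plane with t <= n1 x + r(x) nu cos (theta - t0) <= t + delta
   has area O(delta rho / w).

   For fixed x the set of angles theta has length
   O(delta / sqrt (nu^2 r(x)^2 - (s - n1 x)^2)) for s = t or s = t + delta,
   unless the whole circle lies in the slab, which happens only for x in an
   interval of length O(delta rho / w).  Since S is a quadric, the radicand is
   w^2 q(y / rho) with q a quadratic polynomial, and the hypotheses on rho
   bound below either its concavity or its slope at a root in [0, 1].  So
   q(s) >= c l |s - p| with |s - p| <= l, for one of at most two points p, and
   the integral of (l |s - p|)^(-1/2) over |s - p| <= l does not depend on l. *)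

(** * Quadratic polynomials near their roots *)

Lemma quadratic_root (R : rcfType) (alpha beta gamma s : R) :
  0 <= s -> 0 <= gamma -> 0 < alpha * s ^+ 2 + 2 * beta * s - gamma ->
  exists2 p, 0 <= p <= s & alpha * p ^+ 2 + 2 * beta * p - gamma = 0.
Proof.
move=> s0 g0 qs; pose P := alpha *: 'X^2 + (2 * beta) *: 'X - gamma%:P.
have PE x : P.[x] = alpha * x ^+ 2 + 2 * beta * x - gamma.
  by rewrite /P hornerD hornerN hornerC hornerD !hornerZ hornerXn hornerX.
have [|p ps /rootP] := @poly_ivt R P 0 s s0; last by rewrite PE; exists p.
by rewrite !PE expr0n /= !mulr0; apply/andP; split; lra.
Qed.

(** Write q(s) = alpha s^2 + 2 beta s - tau^2. If alpha <= -c and q takes positive values, it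
    factors over two real roots, and where q is positive the farther root is at distance at least
    half their gap. Otherwise m^2 is controlled by A, which bounds A below; then q, nonpositive at
    0, has a root p before a point where it is positive, and the cofactor of s - p is at least c. *)
Lemma quadratic_lower_bound (R : rcfType) (e c A m eta L tau : R) :
  0 < e <= 1 -> e ^+ 5 = 512 * c -> 0 <= A <= 1 -> eta * e <= 1 -> L <= 1 -> e <= A + m ^+ 2 ->
  exists p1 p2 l, 0 < l /\ forall s, 0 <= s <= L ->
    0 < A * (s * (2 + eta * s)) - (tau + m * s) ^+ 2 ->
    exists p, [/\ p = p1 \/ p = p2, 0 < `|s - p| <= l &
     c * (l * `|s - p|) <= A * (s * (2 + eta * s)) - (tau + m * s) ^+ 2].
Proof.
move=> /andP[e0 e1] cE /andP[A0 A1] etae L1 eAm.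
pose alpha := A * eta - m ^+ 2; pose beta := A - tau * m.
have qE s : A * (s * (2 + eta * s)) - (tau + m * s) ^+ 2 =
    alpha * s ^+ 2 + 2 * beta * s - tau ^+ 2 by rewrite /alpha /beta; ring.
have e50 : 0 < e ^+ 5 by rewrite exprn_gt0.
have c0 : 0 < c by lra.
have e2 : e ^+ 2 = e * e by rewrite expr2.
have e5 : e ^+ 5 <= e ^+ 2 by apply: ler_wiXn2l => //; lra.
have [aN|aP] := lerP alpha (- c).
  pose k := - alpha; have k0 : c <= k by rewrite /k; lra.
  pose D := beta ^+ 2 - k * tau ^+ 2.
  have kq s : k * (alpha * s ^+ 2 + 2 * beta * s - tau ^+ 2) = D - (k * s - beta) ^+ 2.
    by rewrite /D /k; ring.
  have [DN|DP] := lerP D 0.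
    (* With nonpositive discriminant q is never positive, so the witnesses are arbitrary. *)
    exists 0, 0, 1; split=> // s _; rewrite qE => qs; exfalso.
    have : 0 < k * (alpha * s ^+ 2 + 2 * beta * s - tau ^+ 2).
      by rewrite mulr_gt0//; lra.
    by rewrite kq; have := sqr_ge0 (k * s - beta); lra.
  have kp : 0 < k by lra.
  have kN : k != 0 by rewrite gt_eqF.
  pose d := Num.sqrt D / k; pose s0 := beta / k.
  have d0 : 0 < d by rewrite divr_gt0// sqrtr_gt0.
  have kd : (k * d) ^+ 2 = D by rewrite /d mulrC divfK// sqr_sqrtr// ltW.
  have q2 s : alpha * s ^+ 2 + 2 * beta * s - tau ^+ 2 =
      k * ((s - (s0 - d)) * (s0 + d - s)).
    apply: (mulfI kN); rewrite kq -kd /s0; field; exact: kN.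
  (* The scale l = d is half the gap: it bounds the nearer distance above and the farther one
     below. *)
  exists (s0 - d), (s0 + d), d; split=> // s _; rewrite qE q2 => qs.
  have qs' : 0 < (s - (s0 - d)) * (s0 + d - s) by rewrite -(pmulr_rgt0 _ kp).
  have [sl|sr] := lerP s s0.
    have u1 : 0 < s0 + d - s by lra.
    have u2 : 0 < s - (s0 - d) by rewrite -(pmulr_lgt0 _ u1).
    exists (s0 - d); rewrite (gtr0_norm u2); split; [by left|lra|].
    rewrite [d * _]mulrC; apply: ler_pM => //; first exact: ltW.
      by rewrite mulr_ge0 ?ltW.
    by rewrite ler_pM2l//; lra.
  have u1 : 0 < s - (s0 - d) by lra.
  have u2 : 0 < s0 + d - s by rewrite -(pmulr_rgt0 _ u1).
  exists (s0 + d); rewrite distrC (gtr0_norm u2); split; [by right|lra|].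
  apply: ler_pM => //; first exact: ltW.
    by rewrite mulr_ge0 ?ltW.
  by rewrite ler_pM2r//; lra.
have ce : c * e <= e ^+ 2 / 2.
  by rewrite e2 -mulrA [c * e]mulrC ler_pM2l//; have : e ^+ 2 <= e * 1; [rewrite e2 ler_pM2l|]; lra.
(* From m^2 < A eta + c and eta e <= 1. *)
have mA : e * m ^+ 2 <= A + c * e.
  have : e * m ^+ 2 <= e * (A * eta + c) by rewrite ler_pM2l//; rewrite /alpha in aP; lra.
  have : A * (eta * e) <= A * 1 by rewrite ler_wpM2l.
  lra.
have Age : e ^+ 2 / 4 <= A.
  have : e * e <= e * (A + m ^+ 2) by rewrite ler_pM2l.
  have : A * e <= A * 1 by rewrite ler_wpM2l.
  lra.
have m2 : e * m ^+ 2 <= 2 by nra.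
case: (pselect (exists2 s, 0 <= s <= L & 0 < alpha * s ^+ 2 + 2 * beta * s - tau ^+ 2)); last first.
  move=> N; exists 0, 0, 1; split=> // s sL; rewrite qE => qs.
  by exfalso; apply: N; exists s.
move=> [s1 /andP[s10 s1L] qs1].
have [p /andP[p0 ps1] qp] := quadratic_root s10 (sqr_ge0 tau) qs1.
have q3 s : alpha * s ^+ 2 + 2 * beta * s - tau ^+ 2 =
    (s - p) * (alpha * (s + p) + 2 * beta).
  by rewrite -[LHS]subr0 -qp; ring.
suff fc s : 0 <= s <= L -> c <= alpha * (s + p) + 2 * beta.
  exists p, p, 1; split=> // s /[dup] /andP[s0 sL] /fc fs; rewrite qE q3 => qs.
  have sp : 0 < s - p by rewrite -(@pmulr_lgt0 _ (alpha * (s + p) + 2 * beta))//; lra.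
  exists p; rewrite (gtr0_norm sp); split; [by left|lra|].
  by rewrite mul1r mulrC ler_pM2l.
move=> /andP[s0 sL].
(* If beta >= 2 c, then 2 beta outweighs alpha (s + p), as alpha > -c and s + p <= 2. Otherwise tau
   m = A - beta is bounded below, so tau is not small; q(s1) > 0 then forces alpha > 0, and q(p) = 0
   rewrites alpha p + 2 beta as tau^2 / p >= tau^2. *)
have [bB|bB] := lerP (2 * c) beta.
  have : - c * 2 <= alpha * (s + p).
    have [al|al] := lerP 0 alpha; first by have := mulr_ge0 al (addr_ge0 s0 p0); lra.
    nra.
  lra.
have tm : e ^+ 2 / 8 <= tau * m by rewrite /beta in bB; lra.
have tm2 : (e ^+ 2 / 8) ^+ 2 <= (tau * m) ^+ 2.
  by rewrite lerXn2r// nnegrE; have := sqr_ge0 e; lra.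
(* The form of c comes from here: e (e^2 / 8)^2 = e^5 / 64 = 8 c is compared with tau^2 (e m^2) <= 2
   tau^2. *)
have t2 : 4 * c <= tau ^+ 2.
  have : e * (e ^+ 2 / 8) ^+ 2 <= tau ^+ 2 * (e * m ^+ 2).
    by rewrite [leRHS](_ : _ = e * (tau * m) ^+ 2); [rewrite ler_pM2l|ring].
  have : tau ^+ 2 * (e * m ^+ 2) <= tau ^+ 2 * 2 by rewrite ler_wpM2l// sqr_ge0.
  have -> : e * (e ^+ 2 / 8) ^+ 2 = e ^+ 5 / 64 by field.
  rewrite cE.
  lra.
have al0 : 0 < alpha.
  rewrite ltNge; apply/negP => al.
  have : alpha * s1 ^+ 2 <= 0 by rewrite mulr_le0_ge0// sqr_ge0.
  have : 2 * beta * s1 <= 4 * c.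
    have [b0|b0] := lerP 0 beta; nra.
  lra.
have pp : 0 < p.
  rewrite lt_neqAle p0 andbT; apply/eqP => pE; move: qp; rewrite -pE; lra.
have : tau ^+ 2 <= alpha * p + 2 * beta.
  have -> : alpha * p + 2 * beta = tau ^+ 2 / p.
    apply: (mulIf (lt0r_neq0 pp)); rewrite divfK ?lt0r_neq0//; lra.
  by rewrite ler_pdivlMr//; have := sqr_ge0 tau; nra.
have := mulr_ge0 (ltW al0) s0; lra.
Qed.

(** * An integrable substitute for the inverse square root singularity *)

Section Spike.
Context {R : realType}.
Implicit Types p l x : R.
Local Notation mu := (@lebesgue_measure R).

(* A measurable substitute, of integral 4, for the singular weight
   (l * |x - p|)^(-1/2) on |x - p| <= l. *)
Definition spike p l x : \bar R :=
  (\sum_(n <oo) ((2 ^+ n / l)%:E *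
     (\1_(`[p - l / 4 ^+ n, p + l / 4 ^+ n]%classic : set R) x)%:E))%E.

Lemma spike_term_ge0 p l x n : 0 < l -> (0 <= (2 ^+ n / l)%:E *
     (\1_(`[p - l / 4 ^+ n, p + l / 4 ^+ n]%classic : set R) x)%:E)%E.
Proof.
by move=> l0; rewrite mule_ge0 ?lee_fin// divr_ge0 ?exprn_ge0// ltW.
Qed.

Lemma spike_ge0 p l x : 0 < l -> (0 <= spike p l x)%E.
Proof. by move=> l0; apply: nneseries_ge0 => n _ _; exact: spike_term_ge0. Qed.

Lemma measurable_spike_term p l n : measurable_fun setT (fun x => ((2 ^+ n / l)%:E *
     (\1_(`[p - l / 4 ^+ n, p + l / 4 ^+ n]%classic : set R) x)%:E)%E).
Proof.
by apply/measurable_EFinP/measurable_funM.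
Qed.

Lemma measurable_spike p l : 0 < l -> measurable_fun setT (spike p l).
Proof.
move=> l0; apply: (@ge0_emeasurable_sum _ _ _ _ _ xpredT).
  by move=> n x _ _; exact: spike_term_ge0.
by move=> n _; exact: measurable_spike_term.
Qed.

Lemma integral_spike p l : 0 < l -> (\int[mu]_x spike p l x = 4%:E)%E.
Proof.
move=> l0; rewrite integral_nneseries//; first last.
- by move=> n x _; exact: spike_term_ge0.
- by move=> n; exact: measurable_spike_term.
(* The n-th interval has length 2 l / 4^n, so the n-th term integrates to 2 / 2^n, written 4 /
   2^(n+1) to match the geometric series. *)
rewrite (eq_eseriesr (g := fun n => (4 / (2 ^ (n + 1))%:R)%:E)); last first.
  move=> n _; rewrite ge0_integralZl_EFin//; first last.
  - by rewrite divr_ge0 ?exprn_ge0// ltW.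
  - by apply/measurable_EFinP; exact: measurable_indic.
  have ln : 0 < l / 4 ^+ n by rewrite divr_gt0// exprn_gt0.
  have muI : mu `[p - l / 4 ^+ n, p + l / 4 ^+ n]%classic = (2 * (l / 4 ^+ n))%:E.
    rewrite lebesgue_measure_itv/= lte_fin ifT; last by lra.
    by rewrite -EFinB; congr (_%:E); lra.
  rewrite integral_indic// setIT (_ : Measure.sort _ _ = (2 * (l / 4 ^+ n))%:E)//.
  rewrite -EFinM; congr (_%:E).
  rewrite natrX exprD expr1 (_ : (4 : R) = 2 * 2); last by lra.
  by rewrite exprMn; field; rewrite expf_neq0 ?pnatr_eq0 ?gt_eqF.
have := @cvg_geometric_eseries_half R 4 0.
by rewrite expr0 divr1 => /cvg_lim; apply.
Qed.

Lemma spike_ge_inv p l x : 0 < l -> `|x - p| <= l -> ((l^-1)%:E <= spike p l x)%E.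
Proof.
move=> l0 xp; apply: (le_trans _ (nneseries_lim_ge 1 _)); last first.
  by move=> n _ _; exact: spike_term_ge0.
rewrite big_nat1 expr0 divr1 div1r indicE mem_set ?mule1//=.
by rewrite in_itv /=; move: xp; rewrite ler_norml => /andP[? ?]; apply/andP; split; lra.
Qed.

(** On the shell l / 4^(n+1) < |x - p| <= l / 4^n the weight is at most 2^(n+1) / l, twice the n-th
    term of the series. *)
Lemma spike_ge_sqrt p l x : 0 < l -> 0 < `|x - p| <= l ->
  (((Num.sqrt (l * `|x - p|))^-1)%:E <= 2%:E * spike p l x)%E.
Proof.
move=> l0 /andP[u0 ul]; set u := `|x - p| in u0 ul *.
have [N lN] : exists n, l / 4 ^+ n.+1 < u.
  have [N _ NP] : exists2 N, True & l / u < 2 ^+ N.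
    exists (Num.bound (l / u)) => //; exact: upper_nthrootP.
  exists N; rewrite ltr_pdivrMr ?exprn_gt0// mulrC -ltr_pdivrMr//.
  apply: (lt_le_trans NP); rewrite (le_trans (y := 4 ^+ N))//.
    by rewrite lerXn2r ?nnegrE//; lra.
  by rewrite exprS ler_peMl ?exprn_ge0//; lra.
(* Minimality of n gives the outer bound of the shell; for n = 0 that bound is the hypothesis |x -
   p| <= l. *)
have [n nP nmin] := ex_minnP (ex_intro (fun n => l / 4 ^+ n.+1 < u) N lN).
have un : u <= l / 4 ^+ n.
  case: n nP nmin => [|n] nP nmin; first by rewrite expr0 divr1.
  by rewrite leNgt; apply/negP => /nmin; rewrite ltnn.
have t0 : 0 < l / 2 ^+ n.+1 by rewrite divr_gt0// exprn_gt0.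
have sq : l / 2 ^+ n.+1 <= Num.sqrt (l * u).
  rewrite -(ler_pXn2r (ltn0Sn 1)) ?nnegrE ?sqrtr_ge0 ?(ltW t0)//.
  rewrite sqr_sqrtr ?mulr_ge0 ?ltW// expr_div_n -exprM mulnC exprM.
  rewrite (_ : 2 ^+ 2 = 4 :> R); last by lra.
  by rewrite expr2 -mulrA ltr_pM2l.
apply: (@le_trans _ _ (2 * (2 ^+ n / l))%:E).
  rewrite lee_fin mulrA -exprS -invf_div lef_pV2 ?posrE//.
  exact: lt_le_trans sq.
rewrite EFinM lee_pmul2l ?lte_fin//.
apply: (le_trans _ (nneseries_lim_ge n.+1 _)); last first.
  by move=> k _ _; exact: spike_term_ge0.
rewrite big_nat_recr//= indicE mem_set ?mule1/=; last first.
  by rewrite in_itv /=; move: un; rewrite ler_norml => /andP[? ?]; apply/andP; split; lra.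
by rewrite leeDr// sume_ge0// => k _; exact: spike_term_ge0.
Qed.

End Spike.

(** * Monotonicity of the integral *)

Section IntegralMonotone.
Context d (T : measurableType d) (R : realType) (mu : {measure set T -> \bar R}).
Local Open Scope ereal_scope.

(** The integral of a nonnegative function is a supremum over the simple functions below it, and
    that family grows with the function. This allows a pointwise comparison of the area integrand
    with a majorant. *)
Lemma ge0_le_integral_nonmeasurable (D : set T) (f g : T -> \bar R) :
  (forall x, D x -> 0 <= f x) -> (forall x, D x -> f x <= g x) ->
  \int[mu]_(x in D) f x <= \int[mu]_(x in D) g x.
Proof.
move=> f0 fg; rewrite !ge0_integralE//; last first.
  by move=> x Dx; exact: le_trans (f0 _ Dx) (fg _ Dx).
apply: le_ereal_sup => _ [h hf <-]; exists h => // x; apply: le_trans (hf x) _.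
rewrite /patch; case: ifPn => // /set_mem; exact: fg.
Qed.
End IntegralMonotone.

(** * Length of the set of angles cut out by a slab *)

Section ArcMeasure.
Context {R : realType}.
Implicit Types p q x y : R.
Local Notation mu := (@lebesgue_measure R).

Lemma cos_subE x y : cos y - cos x = 2 * sin ((x + y) / 2) * sin ((x - y) / 2).
Proof.
have [yE xE] : y = (x + y) / 2 - (x - y) / 2 /\ x = (x + y) / 2 + (x - y) / 2.
  by split; field.
transitivity (cos ((x + y) / 2 - (x - y) / 2) - cos ((x + y) / 2 + (x - y) / 2)).
  by rewrite -yE -xE.
by rewrite cosB cosD; ring.
Qed.

Lemma sin_addE x y : sin x + sin y = 2 * sin ((x + y) / 2) * cos ((x - y) / 2).
Proof.
have [yE xE] : y = (x + y) / 2 - (x - y) / 2 /\ x = (x + y) / 2 + (x - y) / 2.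
  by split; field.
transitivity (sin ((x + y) / 2 + (x - y) / 2) + sin ((x + y) / 2 - (x - y) / 2)).
  by rewrite -yE -xE.
by rewrite sinB sinD; ring.
Qed.

Lemma cos_nonincreasing x y : 0 <= y -> y <= x -> x <= pi -> cos x <= cos y.
Proof.
move=> y0 yx xpi; have [xI yI] : x \in `[0, pi] /\ y \in `[0, pi].
  by rewrite !in_itv /= y0 xpi (le_trans y0 yx) (le_trans yx xpi).
by rewrite leNgt ltr_cos// -leNgt.
Qed.

Lemma le_acos p q : -1 <= p -> p <= q -> q <= 1 -> acos q <= acos p.
Proof.
move=> p1 pq q1; rewrite leNgt; apply/negP => pq'.
have [p1' q1'] : -1 <= p <= 1 /\ -1 <= q <= 1 by split; apply/andP; split; lra.
have := cos_nonincreasing (acos_ge0 p1') (ltW pq') (acos_lepi q1').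
rewrite !acosK// => qp; move: pq'.
by have -> : p = q by [apply/eqP; rewrite eq_le pq qp]; rewrite ltxx.
Qed.

(** By the mean value theorem sin x = x cos c with c in ]0, x[, and cos decreases on [0, pi]. *)
Lemma mulr_cos_le_sin x : 0 <= x <= pi -> x * cos x <= sin x.
Proof.
move=> /andP[]; rewrite le_eqVlt => /predU1P[<- _|x0 xpi].
  by rewrite mul0r sin0.
have [|c] := @MVT _ sin cos 0 x x0 (fun y _ => is_derive_sin y).
  by apply: continuous_subspaceT => y; exact: continuous_sin.
rewrite in_itv /= => /andP[c0 cx]; rewrite sin0 !subr0 => ->.
by rewrite mulrC ler_pM2r// cos_nonincreasing// ltW.
Qed.

(* The ratio (sin a + sin b) (a - b) / (cos b - cos a) is h / tan h with
   h = (a - b) / 2. *)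
Lemma acos_sub_le p q : -1 <= p -> p <= q -> q <= 1 ->
  (acos p - acos q) * (Num.sqrt (1 - p ^+ 2) + Num.sqrt (1 - q ^+ 2)) <= 2 * (q - p).
Proof.
move=> p1 pq q1; have ba := le_acos p1 pq q1.
have [p1' q1'] : -1 <= p <= 1 /\ -1 <= q <= 1 by split; apply/andP; split; lra.
rewrite -!sin_acos// -{3}(acosK q1') -{3}(acosK p1').
move: ba (acos_ge0 q1') (acos_lepi p1').
set x := acos p; set y := acos q => yx y0 xpi.
rewrite sin_addE cos_subE; set h := (x - y) / 2.
have h0 : 0 <= h by rewrite /h; lra.
have hpi : h <= pi by rewrite /h; lra.
have s0 : 0 <= sin ((x + y) / 2) by apply: sin_ge0_pi; apply/andP; split; lra.
have -> : x - y = 2 * h by rewrite /h; field.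
have /(ler_wpM2l s0) : h * cos h <= sin h by apply: mulr_cos_le_sin; rewrite h0.
lra.
Qed.

(** In [0, pi] the cosine condition selects the interval from acos q to acos p. As t - t0 lies in
    ]-2 pi, 2 pi[, splitting at -pi, 0 and pi and using that cos is even and periodic gives four
    intervals of that length. *)
Lemma measure_arc_acos p q t0 (X : set R) : -1 <= p -> p <= q -> q <= 1 ->
  0 <= t0 < 2 * pi -> measurable X ->
  (forall t, X t -> 0 <= t < 2 * pi /\ p <= cos (t - t0) <= q) ->
  (mu X <= (4 * (acos p - acos q))%:E)%E.
Proof.
move=> p1 pq q1 /andP[t00 t02] mX HX.
have [p1' q1'] : -1 <= p <= 1 /\ -1 <= q <= 1 by split; apply/andP; split; lra.
have pi0 := pi_gt0 R.
have range u : 0 <= u <= pi -> p <= cos u <= q -> acos q <= u <= acos p.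
  move=> /andP[u0 upi] /andP[pu uq].
  have uK : acos (cos u) = u by apply: cosK; rewrite in_itv /= u0.
  by rewrite -uK !le_acos// ?cos_geN1 ?cos_le1.
have ba := le_acos p1 pq q1.
set y := acos q in range ba *; set x := acos p in range ba *.
pose I (c : R) : set R := `[c, c + (x - y)]%classic.
have mI c : measurable (I c) by exact: measurable_itv.
have muI c : mu (I c) = (x - y)%:E.
  rewrite /I lebesgue_measure_itv /= lte_fin; case: ifPn => xy.
    by rewrite -EFinB; congr (_%:E); lra.
  by congr (_%:E); lra.
have XI : X `<=` (I (t0 + y) `|` I (t0 - x)) `|`
    (I (t0 + pi *+ 2 - x) `|` I (t0 - pi *+ 2 + y)).
  move=> t /HX[/andP[t1 t2] pc].
  have [d0|d0] := lerP 0 (t - t0).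
    have [dpi|dpi] := lerP (t - t0) pi.
      have /range : 0 <= t - t0 <= pi by rewrite d0.
      move=> /(_ pc)/andP[? ?]; left; left.
      by rewrite /I /= in_itv /=; apply/andP; split; lra.
    have /range : 0 <= pi *+ 2 - (t - t0) <= pi by apply/andP; split; lra.
    rewrite addrC cosD2pi cosN => /(_ pc)/andP[? ?]; right; left.
    by rewrite /I /= in_itv /=; apply/andP; split; lra.
  have [dpi|dpi] := lerP (- pi) (t - t0).
    have /range : 0 <= - (t - t0) <= pi by apply/andP; split; lra.
    rewrite cosN => /(_ pc)/andP[? ?]; left; right.
    by rewrite /I /= in_itv /=; apply/andP; split; lra.
  have /range : 0 <= t - t0 + pi *+ 2 <= pi by apply/andP; split; lra.
  rewrite cosD2pi => /(_ pc)/andP[? ?]; right; right.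
  by rewrite /I /= in_itv /=; apply/andP; split; lra.
apply: (@le_trans _ _ (mu ((I (t0 + y) `|` I (t0 - x)) `|`
    (I (t0 + pi *+ 2 - x) `|` I (t0 - pi *+ 2 + y))))).
  apply: le_measure => //; rewrite inE//.
  by do 2!apply: measurableU; exact: mI.
have muU (V W : set R) : measurable V -> measurable W ->
    (mu (V `|` W) <= mu V + mu W)%E.
  by move=> mV mW; exact: (@measureU2 _ _ _ mu _ _ mV mW).
apply: le_trans (muU _ _ _ _) _; [by apply: measurableU; exact: mI..|].
apply: le_trans (leeD (muU _ _ (mI _) (mI _)) (muU _ _ (mI _) (mI _))) _.
by rewrite !muI -!EFinD lee_fin; lra.
Qed.

(** A level s with |s - A| < B is crossed transversally, and [acos_sub_le] bounds the arcs by the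
    slope of cos there. If neither bounding level is of this kind, the circle meets the slab in a
    null set of angles or lies entirely inside it. *)
Lemma measure_arc_slab (A B t d t0 : R) (X : set R) :
  0 <= B -> 0 < d -> 0 <= t0 < 2 * pi -> measurable X ->
  (forall u, X u -> 0 <= u < 2 * pi /\ t <= A + B * cos (u - t0) <= t + d) ->
  [\/ (mu X <= 0)%E,
      exists2 s, s = t \/ s = t + d & 0 < B ^+ 2 - (s - A) ^+ 2 /\
        (mu X <= (8 * d * (Num.sqrt (B ^+ 2 - (s - A) ^+ 2))^-1)%:E)%E |
      [/\ t <= A - B, A + B <= t + d & (mu X <= 8%:E)%E] ].
Proof.
move=> B0 d0 t00 mX HX.
have [->|/set0P[u0 /HX[_ /andP[u1 u2]]]] := eqVneq X set0.
  by constructor 1; rewrite measure0.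
have cos1 u := cos_le1 (u : R); have cosN1 u := cos_geN1 (u : R).
have Bc u : - B <= B * cos u <= B.
  by apply/andP; split; have := ler_wpM2l B0 (cos1 u); have := ler_wpM2l B0 (cosN1 u); lra.
have /andP[Bu1 Bu2] := Bc (u0 - t0).
(* The transversal case: in the cosine variable the window has width at most d / B, and one of the
   two square roots in [acos_sub_le] suffices, hence the alternative on D. *)
have key p q D : 0 < B -> -1 <= p -> p <= q -> q <= 1 -> q - p <= d / B ->
    (forall u, X u -> p <= cos (u - t0) <= q) -> 0 < D ->
    D <= B ^+ 2 * (1 - p ^+ 2) \/ D <= B ^+ 2 * (1 - q ^+ 2) ->
    (mu X <= (8 * d * (Num.sqrt D)^-1)%:E)%E.
  move=> Bp p1 pq q1 qpd Hc D0 HD.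
  apply: le_trans (measure_arc_acos p1 pq q1 t00 mX _) _.
    by move=> u Xu; split; [exact: (HX u Xu).1|exact: Hc].
  rewrite lee_fin ler_pdivlMr ?sqrtr_gt0//.
  have DB : Num.sqrt D <= B * (Num.sqrt (1 - p ^+ 2) + Num.sqrt (1 - q ^+ 2)).
    rewrite mulrDr -[in leRHS](ger0_norm B0) -!sqrtr_sqr -!sqrtrM ?sqr_ge0//.
    case: HD => HD.
      by apply: le_trans (ler_wsqrtr HD) _; rewrite lerDl sqrtr_ge0.
    by apply: le_trans (ler_wsqrtr HD) _; rewrite lerDr sqrtr_ge0.
  have ab : 0 <= acos p - acos q by rewrite subr_ge0 le_acos.
  apply: (le_trans (ler_wpM2l _ DB)); first by rewrite mulr_ge0.
  have := ler_wpM2l B0 (acos_sub_le p1 pq q1).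
  have := ler_wpM2l B0 qpd; rewrite [B * (d / B)]mulrC divfK ?gt_eqF//; lra.
have sq s : 0 < B ^+ 2 - (s - A) ^+ 2 -> [/\ 0 < B, -1 < (s - A) / B < 1 &
    B ^+ 2 - (s - A) ^+ 2 = B ^+ 2 * (1 - ((s - A) / B) ^+ 2)].
  move=> Bs; have Bp : 0 < B.
    rewrite lt_neqAle B0 andbT; apply/eqP => BE; move: Bs; rewrite -BE expr0n /=.
    by have := sqr_ge0 (s - A); lra.
  split=> //; last by field; rewrite gt_eqF.
  rewrite ltr_pdivlMr// ltr_pdivrMr//; apply/andP; split; nra.
have [H1|H1] := ltrP 0 (B ^+ 2 - (t - A) ^+ 2).
  constructor 2; exists t; [by left|split=> //].
  have [Bp /andP[p1 p2] E] := sq t H1.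
  (* Truncation at 1 keeps q in the domain of [acos] and only narrows the window. *)
  pose q := Num.min ((t + d - A) / B) 1.
  have Hc u : X u -> (t - A) / B <= cos (u - t0) <= q.
    move=> /HX[_ /andP[H2 H3]]; rewrite le_min cos1 andbT.
    by rewrite ler_pdivrMr// ler_pdivlMr//; apply/andP; split; lra.
  apply: (key ((t - A) / B) q) => //.
  - exact: ltW.
  - rewrite le_min (ltW p2) andbT ler_pM2r ?invr_gt0//; lra.
  - by rewrite ge_min lexx orbT.
  - rewrite lerBlDr ge_min; apply/orP; left.
    by rewrite -mulrDl ler_pM2r ?invr_gt0//; lra.
  - by left; rewrite E.
have [H2|H2] := ltrP 0 (B ^+ 2 - (t + d - A) ^+ 2).
  constructor 2; exists (t + d); [by right|split=> //].
  have [Bp /andP[p1 p2] E] := sq (t + d) H2.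
  pose p := Num.max ((t - A) / B) (-1).
  have Hc u : X u -> p <= cos (u - t0) <= (t + d - A) / B.
    move=> /HX[_ /andP[H3 H4]]; rewrite ge_max cosN1 andbT.
    by rewrite ler_pdivrMr// ler_pdivlMr//; apply/andP; split; lra.
  apply: (key p ((t + d - A) / B)) => //.
  - by rewrite le_max lexx orbT.
  - rewrite ge_max (ltW p1) andbT ler_pM2r ?invr_gt0//; lra.
  - exact: ltW.
  - rewrite lerBlDl -lerBlDr le_max; apply/orP; left.
    by rewrite -mulrBl ler_pM2r ?invr_gt0//; lra.
  - by right; rewrite E.
(* A window reduced to the single value 1 or -1 has zero arc length. *)
have pole e : e = 1 \/ e = - 1 -> (forall u, X u -> e <= cos (u - t0) <= e) -> (mu X <= 0)%E.
  move=> He /= Hc; have [e1 e2] : -1 <= e /\ e <= 1 by case: He => ->; split; lra.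
  rewrite (_ : 0%E = (4 * (acos e - acos e))%:E); last by congr (_%:E); ring.
  by apply: (measure_arc_acos e1 (lexx _) e2 t00 mX) => u Xu; split; [exact: (HX u Xu).1|exact: Hc].
have [tB|tB] := lerP t (A - B); last first.
  constructor 1; apply: (pole 1); first by left.
  move=> u /HX[_ /andP[H3 _]]; rewrite cos1 andbT.
  have : B <= t - A by nra.
  have B1 : 0 < B by lra.
  by move=> H4; rewrite -(ler_pM2l B1); lra.
have [tdB|tdB] := lerP (A + B) (t + d); last first.
  constructor 1; apply: (pole (-1)); first by right.
  move=> u /HX[_ /andP[_ H3]]; rewrite cosN1 /=.
  have : t + d - A <= - B by nra.
  have B1 : 0 < B by lra.
  by move=> H4; rewrite -(ler_pM2l B1); lra.
(* The constant 8 dominates the full turn 2 pi, since pi / 2 <= 2. *)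
constructor 3; split => //.
have muI : mu `[0, 2 * pi]%classic = (2 * pi)%:E.
  rewrite lebesgue_measure_itv /= lte_fin ifT; last by have := pi_gt0 R; lra.
  by rewrite -EFinB; congr (_%:E); lra.
apply: (@le_trans _ _ (mu `[0, 2 * pi]%classic)).
  apply: le_measure; rewrite ?inE// => u /HX[/andP[? ?] _] /=.
  by rewrite in_itv /=; apply/andP; split=> //; exact: ltW.
rewrite muI lee_fin; have [/andP[_ pi2] _] := pihalf_02_cos_pihalf R; lra.
Qed.

End ArcMeasure.

(** * Integrable majorants of the slice measure *)

Section Domination.
Context {R : realType}.
Local Notation mu := (@lebesgue_measure R).

(** The integral bound is packaged with what additivity of the nonnegative integral requires, so
    that majorants can be added and scaled. *)
Definition majorant (g : R -> \bar R) (K : R) : Prop :=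
  [/\ measurable_fun setT g, forall x, (0 <= g x)%E & (\int[mu]_x g x <= K%:E)%E].

Lemma majorantD g1 g2 K1 K2 : majorant g1 K1 -> majorant g2 K2 ->
  majorant (g1 \+ g2)%E (K1 + K2).
Proof.
move=> [m1 p1 i1] [m2 p2 i2]; split; first exact: emeasurable_funD.
  by move=> x; exact: adde_ge0.
by rewrite ge0_integralD//= EFinD; exact: leeD.
Qed.

Lemma majorantZ M g K : 0 <= M -> majorant g K ->
  majorant (fun x => M%:E * g x)%E (M * K).
Proof.
move=> M0 [mg g0 ig]; split.
- exact: measurable_funeM.
- by move=> x; rewrite mule_ge0.
- by rewrite ge0_integralZl_EFin// EFinM lee_wpmul2l.
Qed.

Lemma majorant_spike M p l : 0 <= M -> 0 < l ->
  majorant (fun x => M%:E * spike p l x)%E (M * 4).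
Proof.
move=> M0 l0; apply: majorantZ => //; split; first exact: measurable_spike.
  by move=> x; exact: spike_ge0.
by rewrite integral_spike.
Qed.

Section Slab.
Variables (C a b rho w n1 nu sg si : R).
Hypotheses (C1 : 1 <= C) (a0 : 0 < a) (b0 : 0 < b) (rho0 : 0 < rho) (w0 : 0 < w).
Hypotheses (wE : w ^+ 2 = b ^+ 2 * rho / a) (brho : b ^+ 2 <= C * rho * a).
Hypotheses (rhoa : rho <= C * a) (nuE : n1 ^+ 2 + nu ^+ 2 = 1).
Hypotheses (sgsq : sg ^+ 2 = 1) (sisq : si ^+ 2 = 1).

(** Abscissas are written x = si (a + sg y), with si the sign of x and sg that of the conic (-1 for
    the ellipse, 1 for the hyperbola). The coefficients m and eta remain after rescaling to s = y /
    rho and dividing offsets by w. *)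
Local Notation m := (n1 * si * sg * rho / w).
Local Notation eta := (sg * rho / a).

Local Lemma norm_unit (x : R) : x ^+ 2 = 1 -> `|x| = 1.
Proof. by move/eqP; rewrite sqrf_eq1 => /pred2P[] ->; rewrite ?normrN normr1. Qed.

Local Lemma m2E : m ^+ 2 = n1 ^+ 2 * (rho * a / b ^+ 2).
Proof.
have -> : m ^+ 2 = n1 ^+ 2 * si ^+ 2 * sg ^+ 2 * (rho ^+ 2 / w ^+ 2).
  by field; rewrite gt_eqF.
by rewrite sisq sgsq wE; field; rewrite !gt_eqF.
Qed.

(** Since m^2 = n1^2 rho a / b^2, the lower bound on rho gives m^2 >= n1^2 / C, while n1^2 + nu^2 =
    1. This is the nondegeneracy required by [quadratic_lower_bound] with e = 1 / C. *)
Lemma transversality : C^-1 <= nu ^+ 2 + m ^+ 2.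
Proof.
have C0 : 0 < C := lt_le_trans ltr01 C1.
rewrite m2E -[leLHS]mul1r -nuE mulrDl addrC; apply: lerD.
  by rewrite ler_piMr ?sqr_ge0// invf_le1.
apply: ler_wpM2l; first exact: sqr_ge0.
by rewrite ler_pdivlMr ?exprn_gt0// mulrC ler_pdivrMr// mulrC mulrA.
Qed.

Lemma normal_offsetE t y : t - n1 * (si * (a + sg * y)) =
  - w * ((n1 * si * a - t) / w + m * (y / rho)).
Proof. by field; rewrite !gt_eqF. Qed.

Lemma sqr_profileE y : nu ^+ 2 * (b ^+ 2 / a ^+ 2 * (y * (2 * a + sg * y))) =
  w ^+ 2 * (nu ^+ 2 * (y / rho * (2 + eta * (y / rho)))).
Proof. by rewrite wE; field; rewrite !gt_eqF. Qed.

Lemma norm_abscissa_sub y p :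
  `|si * (a + sg * y) - si * (a + sg * (rho * p))| = rho * `|y / rho - p|.
Proof.
have -> : si * (a + sg * y) - si * (a + sg * (rho * p)) =
    si * sg * (rho * (y / rho - p)) by field; rewrite gt_eqF.
by rewrite !normrM (gtr0_norm rho0) (norm_unit sisq) (norm_unit sgsq) !mul1r.
Qed.

(** After rescaling, D = w^2 q(y / rho), so [quadratic_lower_bound] confines the singularity of the
    inverse square root to two points, and one spike at each absorbs it. *)
Lemma discriminant_majorant c t : C^-1 ^+ 5 = 512 * c ->
  exists2 g, majorant g (16 * rho / (w * Num.sqrt c)) &
  forall y, 0 <= y <= rho ->
    let D := nu ^+ 2 * (b ^+ 2 / a ^+ 2 * (y * (2 * a + sg * y))) -
             (t - n1 * (si * (a + sg * y))) ^+ 2 in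
    0 < D -> ((Num.sqrt D)^-1%:E <= g (si * (a + sg * y))%R)%E.
Proof.
move=> cE.
have C0 : 0 < C := lt_le_trans ltr01 C1.
have c0 : 0 < c by have : 0 < C^-1 ^+ 5 by [rewrite exprn_gt0// invr_gt0]; lra.
have sc0 : 0 < Num.sqrt c by rewrite sqrtr_gt0.
have e01 : 0 < C^-1 <= 1 by rewrite invr_gt0 C0 invf_le1.
have nu01 : 0 <= nu ^+ 2 <= 1 by rewrite sqr_ge0 /=; move: nuE (sqr_ge0 n1); lra.
have etaC : eta * C^-1 <= 1.
  have sgle : sg <= 1 by rewrite -(norm_unit sgsq) ler_norm.
  rewrite ler_pdivrMr// mul1r ler_pdivrMr//; apply: le_trans rhoa.
  by rewrite ler_piMl// ltW.
have [p1 [p2 [l [l0 H]]]] := @quadratic_lower_bound R C^-1 c (nu ^+ 2) m eta 1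
  ((n1 * si * a - t) / w) e01 cE nu01 etaC (lexx 1) transversality.
have rl0 : 0 < rho * l by rewrite mulr_gt0.
pose P p := si * (a + sg * (rho * p)).
(* Passing from s to x gives rho^2 l |s - p| = rho l |x - P p|, whence the factor rho / (w sqrt c);
   the 2 is the loss in [spike_ge_sqrt]. *)
pose M := 2 * rho / (w * Num.sqrt c).
have M0 : 0 <= M by rewrite /M divr_ge0 ?mulr_ge0 ?ltW.
exists (fun x => M%:E * spike (P p1) (rho * l)%R x + M%:E * spike (P p2) (rho * l)%R x)%E.
  rewrite (_ : 16 * rho / (w * Num.sqrt c) = M * 4 + M * 4); last first.
    by rewrite /M; field; rewrite !gt_eqF.
  by apply: majorantD; exact: majorant_spike.
move=> y /andP[y0 yr] D; rewrite /D {D} sqr_profileE normal_offsetE.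
set q := nu ^+ 2 * _; set tau := (_ - _) / w; set s := y / rho.
have -> : w ^+ 2 * q - (- w * (tau + m * s)) ^+ 2 = w ^+ 2 * (q - (tau + m * s) ^+ 2) by ring.
rewrite pmulr_rgt0 ?exprn_gt0// => q0.
have s01 : 0 <= s <= 1 by rewrite divr_ge0 ?(ltW rho0)//= ler_pdivrMr// mul1r.
have [p [pE /andP[sp spl] qp]] := H s s01 q0.
have xp := norm_abscissa_sub y p.
apply: (@le_trans _ _ (M%:E * spike (P p) (rho * l)%R (si * (a + sg * y))%R)%E); last first.
  by case: pE => ->; rewrite ?leeDl ?leeDr ?mule_ge0 ?spike_ge0.
have -> : M = rho / (w * Num.sqrt c) * 2 by rewrite /M; field; rewrite !gt_eqF.
rewrite EFinM -muleA.
apply: (le_trans _ (lee_wpmul2l _ (spike_ge_sqrt rl0 _))); last 2 first.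
- by rewrite lee_fin divr_ge0 ?mulr_ge0 ?ltW.
- by rewrite /P xp mulr_gt0//= ler_pM2l.
rewrite -EFinM lee_fin /P xp -/s -[rho / _]invf_div -invfM lef_pV2 ?posrE; last 2 first.
- by rewrite sqrtr_gt0 mulr_gt0 ?exprn_gt0.
- by rewrite mulr_gt0 ?divr_gt0 ?mulr_gt0// sqrtr_gt0 !mulr_gt0.
have -> : rho * l * (rho * `|s - p|) = rho ^+ 2 * (l * `|s - p|) by ring.
rewrite (sqrtrM _ (sqr_ge0 rho)) (sqrtrM _ (sqr_ge0 w)) !sqrtr_sqr (gtr0_norm rho0) (gtr0_norm w0).
have -> : w * Num.sqrt c / rho * (rho * Num.sqrt (l * `|s - p|)) =
   w * (Num.sqrt c * Num.sqrt (l * `|s - p|)) by field; rewrite gt_eqF.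
by rewrite ler_pM2l// -(sqrtrM _ (ltW c0)) ler_wsqrtr.
Qed.

(** A circle inside the slab satisfies 2 r <= d and 0 <= tau + m s <= d / w. By [transversality]
    either m^2 or nu^2 is at least 1 / (2 C): in the first case the offset confines s to a short
    interval, in the second the radius does. *)
Lemma pole_majorant t d : 0 < d ->
  exists2 g, majorant g (64 * C * d * rho / w) &
  forall y r, 0 <= y <= rho -> - a <= sg * y -> 0 <= r ->
    r ^+ 2 = nu ^+ 2 * (b ^+ 2 / a ^+ 2 * (y * (2 * a + sg * y))) ->
    t <= n1 * (si * (a + sg * y)) - r -> n1 * (si * (a + sg * y)) + r <= t + d ->
    (8%:E <= g (si * (a + sg * y))%R)%E.
Proof.
move=> d0; have C0 : 0 < C := lt_le_trans ltr01 C1.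
pose tau := (n1 * si * a - t) / w; pose d' := d / w.
have d'0 : 0 < d' by rewrite divr_gt0.
have [p Hp] : exists p, forall y r, 0 <= y <= rho -> - a <= sg * y -> 0 <= r ->
    r ^+ 2 = nu ^+ 2 * (b ^+ 2 / a ^+ 2 * (y * (2 * a + sg * y))) ->
    t <= n1 * (si * (a + sg * y)) - r -> n1 * (si * (a + sg * y)) + r <= t + d ->
    `|y / rho - p| <= 2 * C * d'.
  have range y r : 0 <= r -> t <= n1 * (si * (a + sg * y)) - r ->
      n1 * (si * (a + sg * y)) + r <= t + d ->
      [/\ 0 <= tau + m * (y / rho), tau + m * (y / rho) <= d' & 2 * r <= d].
    move=> r0 H1 H2; have := normal_offsetE t y; rewrite -/tau => E; split; last by lra.
      by rewrite -(pmulr_rge0 _ w0); lra.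
    by rewrite /d' ler_pdivlMr// mulrC; lra.
  have [mB|mS] := lerP (2 * C)^-1 (m ^+ 2).
    exists (- tau / m) => y r _ _ r0 _ H1 H2.
    have [h1 h2 _] := range y r r0 H1 H2; set s := y / rho in h1 h2 *.
    have m0 : m != 0.
      apply/eqP => mE; move: mB; rewrite mE expr0n /= leNgt invr_gt0 mulr_gt0//.
    have -> : s - - tau / m = (tau + m * s) / m.
      by rewrite mulrDl [m * s]mulrC mulfK// mulNr opprK addrC.
    rewrite normrM normfV (ger0_norm h1) ler_pdivrMr ?normr_gt0//.
    apply: (le_trans h2).
    rewrite (_ : 2 * C * d' * `|m| = 2 * C * `|m| * d'); last by rewrite mulrAC.
    rewrite ler_peMl ?(ltW d'0)//.
    rewrite -(ler_pXn2r (ltn0Sn 1)) ?nnegrE ?mulr_ge0 ?normr_ge0 ?(ltW C0)// expr1n.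
    rewrite exprMn real_normK ?num_real//.
    have : (2 * C) * (2 * C)^-1 <= (2 * C) * m ^+ 2 by rewrite ler_wpM2l// mulr_ge0 ?ltW.
    rewrite divff ?mulf_neq0 ?gt_eqF// => h3.
    have C2 : 1 <= 2 * C by move: C1; lra.
    apply: (le_trans C2); have := ler_wpM2l (le_trans ler01 C2) h3.
    by rewrite mulr1 [(2 * C) ^+ 2]expr2 !mulrA.
  (* Now nu^2 >= 1 / (2 C), and the interval is centred at the pole y = 0. From 2 r <= d and r^2 >=
     w^2 nu^2 s, s is of order d'^2, hence of order d' when d' < 1; for d' >= 1 the bound s <= 1 is
     enough. *)
  exists 0 => y r /andP[y0 yr] ya r0 rE H1 H2.
  have [_ _ h] := range y r r0 H1 H2; rewrite subr0.
  have s0 : 0 <= y / rho by rewrite divr_ge0 ?(ltW rho0).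
  have s1 : y / rho <= 1 by rewrite ler_pdivrMr// mul1r.
  rewrite (ger0_norm s0).
  have [d1|d1] := lerP 1 d'; first by move: C1; nra.
  rewrite sqr_profileE in rE; set s := y / rho in rE s0 s1 *.
  have etas : -1 <= eta * s.
    rewrite (_ : eta * s = sg * y / a); last by rewrite /s; field; rewrite !gt_eqF.
    by rewrite ler_pdivlMr// mulN1r.
  have nuC : C^-1 / 2 <= nu ^+ 2.
    have := transversality; rewrite invfM in mS; lra.
  have rd : 4 * r ^+ 2 <= d ^+ 2 by nra.
  have : 4 * (nu ^+ 2 * s) <= d' ^+ 2.
    rewrite /d' expr_div_n ler_pdivlMr ?exprn_gt0//; apply: le_trans rd.
    suff : w ^+ 2 * (nu ^+ 2 * s) <= r ^+ 2 by lra.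
    rewrite rE ler_pM2l ?exprn_gt0//.
    by rewrite ler_wpM2l ?sqr_ge0// ler_peMr//; lra.
  have : C^-1 / 2 * s <= nu ^+ 2 * s by rewrite ler_wpM2r.
  move=> h1 h2.
  have h3 : C * (C^-1 / 2 * s) = s / 2 by field; rewrite gt_eqF.
  have h4 : 2 * s <= C * d' ^+ 2.
    have := ler_wpM2l (ltW C0) h2; have := ler_wpM2l (ltW C0) h1; lra.
  have : C * d' ^+ 2 <= C * d' by rewrite ler_pM2l// expr2 ler_piMr ?ltW.
  have := mulr_gt0 C0 d'0; lra.
pose l := rho * (2 * C * d').
have l0 : 0 < l by rewrite mulr_gt0// mulr_gt0// mulr_gt0.
exists (fun x => (8 * l)%:E * spike (si * (a + sg * (rho * p)))%R l x)%E.
  rewrite (_ : 64 * C * d * rho / w = 8 * l * 4).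
    by apply: majorant_spike => //; rewrite mulr_ge0 ?ltW.
  by rewrite /l /d'; field; rewrite gt_eqF.
move=> y r H1 H2 H3 H4 H5 H6; have Hy := Hp y r H1 H2 H3 H4 H5 H6.
apply: (le_trans _ (lee_wpmul2l _ (spike_ge_inv l0 _))); last 2 first.
- by rewrite lee_fin mulr_ge0 ?ltW.
- by rewrite norm_abscissa_sub /l ler_pM2l.
by rewrite -EFinM -mulrA divff ?mulr1 ?gt_eqF.
Qed.

(** One majorant per alternative of [measure_arc_slab] that is not null: one for each bounding
    plane, contributing 8 times 16 each, and one for circles inside the slab. *)
Lemma slice_majorant c t d t0 : C^-1 ^+ 5 = 512 * c -> 0 <= nu -> 0 < d ->
  0 <= t0 < 2 * pi ->
  exists2 g, majorant g ((256 / Num.sqrt c + 64 * C) * (d * rho / w)) &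
  forall y r (X : set R), 0 <= y <= rho -> - a <= sg * y -> 0 <= r ->
    r ^+ 2 = b ^+ 2 / a ^+ 2 * (y * (2 * a + sg * y)) -> measurable X ->
    (forall u, X u -> 0 <= u < 2 * pi /\
       t <= n1 * (si * (a + sg * y)) + r * nu * cos (u - t0) <= t + d) ->
    (mu X <= g (si * (a + sg * y))%R)%E.
Proof.
move=> cE nu0 d0 t00.
have [g1 G1 H1] := discriminant_majorant t cE.
have [g2 G2 H2] := discriminant_majorant (t + d) cE.
have [g3 G3 H3] := pole_majorant t d0.
have C0 : 0 < C := lt_le_trans ltr01 C1.
have c0 : 0 < c by have : 0 < C^-1 ^+ 5 by [rewrite exprn_gt0// invr_gt0]; lra.
have sc0 : 0 < Num.sqrt c by rewrite sqrtr_gt0.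
have d80 : 0 <= 8 * d by rewrite mulr_ge0// ltW.
exists ((fun x => (8 * d)%:E * g1 x) \+ (fun x => (8 * d)%:E * g2 x) \+ g3)%E.
  rewrite (_ : (256 / _ + _) * _ = 8 * d * (16 * rho / (w * Num.sqrt c)) +
     8 * d * (16 * rho / (w * Num.sqrt c)) + 64 * C * d * rho / w); last first.
    by field; rewrite !gt_eqF.
  by apply: majorantD => //; apply: majorantD; exact: majorantZ.
have [_ g10 _] := G1; have [_ g20 _] := G2; have [_ g30 _] := G3.
move=> y r X yr ya r0 rE mX HX.
have nn x : [/\ (0 <= (8 * d)%:E * g1 x)%E, (0 <= (8 * d)%:E * g2 x)%E & (0 <= g3 x)%E].
  by split=> //; rewrite mule_ge0.
have [p1 p2 p3] := nn (si * (a + sg * y)).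
have rn0 : 0 <= r * nu by rewrite mulr_ge0.
have rnE : (r * nu) ^+ 2 = nu ^+ 2 * (b ^+ 2 / a ^+ 2 * (y * (2 * a + sg * y))).
  by rewrite exprMn rE mulrC.
have [X0|[s sE []]|[h1 h2 X8]] := measure_arc_slab rn0 d0 t00 mX HX.
- by apply: (le_trans X0); rewrite !adde_ge0.
- rewrite rnE => D0 /le_trans; apply; rewrite EFinM.
  case: sE => sE; rewrite sE in D0 *.
    apply: (@le_trans _ _ ((8 * d)%:E * g1 (si * (a + sg * y))%R)%E).
      by rewrite lee_wpmul2l ?lee_fin// H1.
    by rewrite /= -addeA leeDl// adde_ge0.
  apply: (@le_trans _ _ ((8 * d)%:E * g2 (si * (a + sg * y))%R)%E).
    by rewrite lee_wpmul2l ?lee_fin// H2.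
  by rewrite /= [X in (_ <= X + _)%E]addeC -addeA leeDl// adde_ge0.
- apply: (le_trans X8); apply: (@le_trans _ _ (g3 (si * (a + sg * y)))).
    by apply: (H3 y (r * nu)).
  by rewrite /= leeDr// adde_ge0.
Qed.

End Slab.
End Domination.

(** * A common description of both conics *)

Section Quadric.
Context {R : realType}.
Variables (k : conic) (a b : R).
Hypotheses (a0 : 0 < a) (b0 : 0 < b).

Local Notation prof := (profile k a b).

(** The sign for which r^2 = sg (b^2 / a^2) (x^2 - a^2) on the profile and c^2 = a^2 + sg b^2, so
    that one computation serves both conics. *)
Definition conic_sign : R := if k is Ellipse then -1 else 1.

Local Notation sg := conic_sign.

Lemma sqr_conic_sign : sg ^+ 2 = 1.
Proof. by rewrite /conic_sign; case: k; rewrite ?sqrrN expr1n. Qed.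

(** On the profile domain this is the quantity ||x| - a|. *)
Definition pole_distance (x : R) : R := sg * (`|x| - a).

Lemma profile_domainE x : profile_domain k a x <-> 0 <= pole_distance x.
Proof. by rewrite /pole_distance /conic_sign; case: k; split=> /= xa; lra. Qed.

Lemma norm_pole_distance x : `|x| = a + sg * pole_distance x.
Proof.
by rewrite /pole_distance mulrA -expr2 sqr_conic_sign mul1r addrC subrK.
Qed.

Lemma sqr_profile_pole x : profile_domain k a x ->
  prof x ^+ 2 = b ^+ 2 / a ^+ 2 * (pole_distance x * (2 * a + sg * pole_distance x)).
Proof.
move=> xD; have y0 := (profile_domainE x).1 xD; have aN0 : a != 0 by rewrite gt_eqF.
have x2 : x ^+ 2 = (a + sg * pole_distance x) ^+ 2.
  by rewrite -norm_pole_distance real_normK// num_real.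
have ye : sg * pole_distance x = `|x| - a by rewrite norm_pole_distance addrAC subrr add0r.
have x0 := normr_ge0 x.
rewrite /profile; move: x2 ye y0 xD; rewrite /conic_sign.
case: k => /= x2 ye y0 xD; rewrite exprMn sqr_sqrtr.
- by rewrite x2; field.
- by rewrite subr_ge0 ler_pdivrMr ?exprn_gt0// mul1r x2; move: a0 x0; nra.
- by rewrite x2; field.
- by rewrite subr_ge0 ler_pdivlMr ?exprn_gt0// mul1r x2; move: a0 x0; nra.
Qed.

Lemma is_derive_profile x : profile_domain k a x -> `|x| != a ->
  is_derive x 1 prof (sg * (b ^+ 2 * x / a ^+ 2) / prof x).
Proof.
move=> xD xa; have aN0 : a != 0 by rewrite gt_eqF.
have x2 : `|x| ^+ 2 = x ^+ 2 by rewrite real_normK// num_real.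
have n0 := normr_ge0 x.
rewrite /profile /conic_sign; move: xD; case: k => /= xD.
- have u0 : 0 < 1 - x ^+ 2 / a ^+ 2.
    rewrite subr_gt0 ltr_pdivrMr ?exprn_gt0// mul1r -x2.
    have : `|x| < a by rewrite lt_neqAle xa.
    by move: a0 n0; nra.
  have s0 : Num.sqrt (1 - x ^+ 2 / a ^+ 2) != 0 by rewrite gt_eqF// sqrtr_gt0.
  pose u (x : R) := 1 - x ^+ 2 / a ^+ 2.
  have du : is_derive x 1 u (- (2 * x / a ^+ 2)).
    by apply: is_derive_eq; rewrite /GRing.scale /=; field.
  have ds : is_derive (u x) 1 Num.sqrt (2 * Num.sqrt (u x))^-1 := is_derive1_sqrt u0.
  have dc := is_derive1_comp ds du.
  apply: (is_derive_eq (is_deriveZ b dc)); rewrite /GRing.scale /= /u; field.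
  by rewrite s0 aN0 gt_eqF.
- have u0 : 0 < x ^+ 2 / a ^+ 2 - 1.
    rewrite subr_gt0 ltr_pdivlMr ?exprn_gt0// mul1r -x2.
    have : a < `|x| by rewrite lt_neqAle eq_sym xa.
    by move: a0 n0; nra.
  have s0 : Num.sqrt (x ^+ 2 / a ^+ 2 - 1) != 0 by rewrite gt_eqF// sqrtr_gt0.
  pose u (x : R) := x ^+ 2 / a ^+ 2 - 1.
  have du : is_derive x 1 u (2 * x / a ^+ 2).
    by apply: is_derive_eq; rewrite /GRing.scale /=; field.
  have ds : is_derive (u x) 1 Num.sqrt (2 * Num.sqrt (u x))^-1 := is_derive1_sqrt u0.
  have dc := is_derive1_comp ds du.
  apply: (is_derive_eq (is_deriveZ b dc)); rewrite /GRing.scale /= /u; field.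
  by rewrite s0 aN0 gt_eqF.
Qed.

End Quadric.

(** * Area element and distance to a focus *)

Lemma dot_vec3 (R : realType) (x y z x' y' z' : R) :
  dot (vec3 x y z) (vec3 x' y' z') = x * x' + y * y' + z * z'.
Proof. by rewrite /dot !big_ord_recr big_ord0 /= add0r !mxE. Qed.

(** The product r r' is kept together because it is half the derivative of r^2, which stays bounded
    at the poles although r' does not. *)
Lemma area_element_rotate (R : realType) (r : R -> R) (x theta r' : R) :
  is_derive x 1 r r' ->
  area_element (fun x theta => rotate x (r x) theta) x theta =
    Num.sqrt (r x ^+ 2 + (r x * r') ^+ 2).
Proof.
move=> dr; rewrite /area_element.
have drM c : 'D_1 (fun s => r s * c) x = r' * c.
  have -> : (fun s => r s * c) = c \*: r by apply/funext => s; rewrite /= mulrC.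
  by rewrite (derive_val (is_derive := is_deriveZ c dr)) mulrC.
have -> : partial1 (fun x theta => rotate x (r x) theta) x theta =
    vec3 1 (r' * cos theta) (r' * sin theta).
  apply/rowP => i; rewrite !mxE derive1E; case: i => -[|[|[|//]]] /= ?.
  - by under eq_fun do rewrite mxE /=; rewrite derive_id.
  - by under eq_fun do rewrite mxE /=; exact: drM.
  - by under eq_fun do rewrite mxE /=; exact: drM.
have -> : partial2 (fun x theta => rotate x (r x) theta) x theta =
    vec3 0 (- (r x * sin theta)) (r x * cos theta).
  apply/rowP => i; rewrite !mxE derive1E; case: i => -[|[|[|//]]] /= ?.
  - by under eq_fun do rewrite mxE /=; rewrite derive_cst.
  - under eq_fun do rewrite mxE /=.
    rewrite (derive_val (is_derive := is_deriveZ (r x) (is_derive_cos theta))).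
    by rewrite /GRing.scale /= mulrN.
  - under eq_fun do rewrite mxE /=.
    by rewrite (derive_val (is_derive := is_deriveZ (r x) (is_derive_sin theta))).
rewrite !dot_vec3; congr Num.sqrt; have := cos2Dsin2 theta => cs.
transitivity ((1 + r' ^+ 2 * (cos theta ^+ 2 + sin theta ^+ 2)) *
   (r x ^+ 2 * (cos theta ^+ 2 + sin theta ^+ 2))); first by ring.
by rewrite cs; ring.
Qed.

Section QuadricMeasure.
Context {R : realType}.
Variables (k : conic) (a b C rho w : R).
Hypotheses (C1 : 1 <= C) (a0 : 0 < a) (b0 : 0 < b) (ba : b <= a).
Hypotheses (w0 : 0 < w) (wE : w ^+ 2 = b ^+ 2 * rho / a).
Hypotheses (brho : b ^+ 2 <= C * rho * a) (rhoa : rho <= C * a).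

Local Notation prof := (profile k a b).
Local Notation sg := (@conic_sign R k).
Local Notation c := (focal_distance k a b).

Lemma sqr_focal_distance : c ^+ 2 = a ^+ 2 + sg * b ^+ 2.
Proof.
rewrite /focal_distance /conic_sign; case: k; rewrite sqr_sqrtr ?mulN1r ?mul1r//.
  by rewrite subr_ge0 lerXn2r ?nnegrE// ltW.
by rewrite addr_ge0 ?sqr_ge0.
Qed.

(* The distance from a point of the quadric to the focus at abscissa
   e * c, with e = 1 or e = -1, is |a - e * c * x / a|. *)
Lemma pole_distance_le_focal (F : 'rV[R]_3) x theta : foci k a b F ->
  profile_domain k a x -> closed_eball F rho (rotate x (prof x) theta) ->
  pole_distance k a x <= rho.
Proof.
move=> HF xD; have aN0 : a != 0 by rewrite gt_eqF.
have [e [e1 ->]] : exists e : R, e ^+ 2 = 1 /\ F = vec3 (e * c) 0 0.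
  case: HF => ->; [exists 1|exists (-1)]; rewrite ?sqrrN expr1n; split=> //.
    by rewrite mul1r.
  by rewrite mulN1r.
rewrite /closed_eball /= /enorm.
have -> : rotate x (prof x) theta - vec3 (e * c) 0 0 =
    vec3 (x - e * c) (prof x * cos theta) (prof x * sin theta).
  by apply/rowP => i; rewrite !mxE; case: i => -[|[|[|//]]] /= ?; rewrite ?subr0.
have x2 : x ^+ 2 = (a + sg * pole_distance k a x) ^+ 2.
  by rewrite -norm_pole_distance real_normK// num_real.
have r2 : prof x ^+ 2 = sg * (b ^+ 2 / a ^+ 2) * (x ^+ 2 - a ^+ 2).
  rewrite sqr_profile_pole// x2.
  transitivity (b ^+ 2 / a ^+ 2 * (2 * a * (sg ^+ 2 * pole_distance k a x) +
    sg * (sg ^+ 2 * pole_distance k a x ^+ 2))); last by ring.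
  by rewrite !sqr_conic_sign; ring.
have -> : dot (vec3 (x - e * c) (prof x * cos theta) (prof x * sin theta))
    (vec3 (x - e * c) (prof x * cos theta) (prof x * sin theta)) =
    (a - e * c * x / a) ^+ 2.
  rewrite dot_vec3.
  transitivity (x ^+ 2 - 2 * e * c * x + e ^+ 2 * c ^+ 2 +
     prof x ^+ 2 * (cos theta ^+ 2 + sin theta ^+ 2)); first by ring.
  rewrite cos2Dsin2 r2 e1 sqr_focal_distance.
  transitivity (a ^+ 2 - 2 * a * (e * c * x / a) + e ^+ 2 * c ^+ 2 * x ^+ 2 / a ^+ 2).
    by rewrite e1 sqr_focal_distance; field.
  by field.
rewrite sqrtr_sqr; apply: le_trans; rewrite /pole_distance.
have xN := normr_ge0 x.
have vE : `|e * c * x / a| = c * `|x| / a.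
  rewrite !normrM normfV (gtr0_norm a0).
  have -> : `|e| = 1.
    by move/eqP: e1; rewrite sqrf_eq1 => /pred2P[] ->; rewrite ?normrN normr1.
  by rewrite mul1r ger0_norm// /focal_distance; case: k; exact: sqrtr_ge0.
have := sqr_focal_distance.
have c0 : 0 <= c by rewrite /focal_distance; case: k; exact: sqrtr_ge0.
set v := e * c * x / a in vE *.
(* For the ellipse c <= a gives |v| <= |x|, so a - |x| <= |a - v|; for the hyperbola c >= a gives
   |x| <= |v|, so |x| - a <= |a - v|. *)
move: xD; rewrite /conic_sign; case: {r2 x2} k vE c0 => /= vE c0 xD cE.
- have ca : focal_distance Ellipse a b <= a.
    by rewrite -(@ler_pXn2r _ 2) ?nnegrE ?(ltW a0)// cE; have := sqr_ge0 b; lra.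
  have : `|v| <= `|x|.
    by rewrite vE ler_pdivrMr// mulrC ler_wpM2l.
  have := ler_norm v; have := ler_norm (a - v); lra.
- have ca : a <= focal_distance Hyperbola a b.
    by rewrite -(@ler_pXn2r _ 2) ?nnegrE ?(ltW a0)// cE; have := sqr_ge0 b; lra.
  have : `|x| <= `|v|.
    by rewrite vE ler_pdivlMr// mulrC ler_wpM2r.
  have := lerB_dist v a; rewrite (gtr0_norm a0) distrC; lra.
Qed.

(** With y <= rho <= C a and b^2 <= C rho a, one gets r^2 <= 3 C w^2 and (r r')^2 = (b^2 x / a^2)^2
    <= 4 C^3 w^2, whose sum is at most 9 C^4 w^2. *)
Lemma area_element_le x theta : profile_domain k a x -> `|x| != a ->
  pole_distance k a x <= rho ->
  area_element (quadric_param k a b) x theta <= 3 * C ^+ 2 * w.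
Proof.
move=> xD xa yr; have aN0 : a != 0 by rewrite gt_eqF.
have y0 := (profile_domainE k a x).1 xD; have xE := norm_pole_distance k a x.
set y := pole_distance k a x in yr y0 xE.
rewrite /quadric_param (area_element_rotate theta (is_derive_profile a0 b0 xD xa)).
have w2 : 0 < w ^+ 2 by rewrite exprn_gt0.
have C0 : 0 < C := lt_le_trans ltr01 C1.
have K0 : 0 <= 3 * C ^+ 2 * w by rewrite !mulr_ge0 ?sqr_ge0// ltW.
rewrite -[leRHS](ger0_norm K0) -sqrtr_sqr ler_wsqrtr//.
have sg1 : sg * y <= y.
  by rewrite /conic_sign; case: k; rewrite ?mul1r// mulN1r; lra.
have r2 : prof x ^+ 2 <= 3 * C * w ^+ 2.
  rewrite sqr_profile_pole// -/y.
  have -> : 3 * C * w ^+ 2 = b ^+ 2 / a ^+ 2 * (rho * (3 * C * a)).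
    by rewrite wE; field.
  rewrite ler_wpM2l ?divr_ge0 ?sqr_ge0//; apply: ler_pM => //.
    by move: (normr_ge0 x) a0; rewrite xE; lra.
  have : a <= C * a by rewrite ler_peMl// ltW.
  by move: yr rhoa sg1; lra.
have rr : (prof x * (sg * (b ^+ 2 * x / a ^+ 2) / prof x)) ^+ 2 <= 4 * C ^+ 3 * w ^+ 2.
  have [->|r0] := eqVneq (prof x) 0.
    by rewrite mul0r expr0n /= !mulr_ge0 ?exprn_ge0 ?(ltW C0)// ltW.
  rewrite mulrC divfK// exprMn sqr_conic_sign mul1r.
  have -> : (b ^+ 2 * x / a ^+ 2) ^+ 2 = b ^+ 2 / a ^+ 4 * (b ^+ 2 * `|x| ^+ 2).
    by rewrite real_normK ?num_real//; field.
  have -> : 4 * C ^+ 3 * w ^+ 2 = b ^+ 2 / a ^+ 4 * ((C * rho * a) * (2 * C * a) ^+ 2).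
    by rewrite wE; field.
  rewrite ler_wpM2l ?divr_ge0 ?exprn_ge0 ?(ltW a0) ?(ltW b0)//.
  apply: ler_pM; rewrite ?sqr_ge0//.
  rewrite lerXn2r ?nnegrE ?mulr_ge0 ?(ltW C0) ?(ltW a0)// xE.
  have : a <= C * a by rewrite ler_peMl// ltW.
  by move: yr rhoa sg1; lra.
have C2 : 1 <= C ^+ 2 by rewrite exprn_ege1.
have -> : (3 * C ^+ 2 * w) ^+ 2 = 9 * (C ^+ 2 * C ^+ 2) * w ^+ 2 by ring.
have : 3 * C + 4 * C ^+ 3 <= 9 * (C ^+ 2 * C ^+ 2).
  have -> : C ^+ 3 = C * C ^+ 2 by rewrite exprS.
  have CC : C <= C ^+ 2 by rewrite expr2 ler_peMl// ltW.
  have : C * C ^+ 2 <= C ^+ 2 * C ^+ 2 by rewrite ler_wpM2r// sqr_ge0.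
  have : C * 1 <= C * C ^+ 2 by rewrite ler_wpM2l// ltW.
  have : 0 <= C ^+ 2 * C ^+ 2 by rewrite mulr_ge0 ?sqr_ge0.
  lra.
by move=> /(ler_wpM2r (ltW w2)); rewrite mulrDl; lra.
Qed.

End QuadricMeasure.

(** * Measure of the parameter region *)

Lemma measurable_profile (R : realType) (k : conic) (a b : R) :
  measurable_fun setT (profile k a b).
Proof.
(* [Num.sqrt] is 0 on negative arguments, hence continuous on the whole line. *)
have msq : measurable_fun setT (@Num.sqrt R).
  by apply: continuous_measurable_fun; exact: sqrt_continuous.
rewrite /profile; case: k; apply: measurable_funM => //;
  apply: (measurableT_comp msq); apply: measurable_funB => //;
  by apply: measurable_funM => //; exact: measurable_funX.
Qed.

Section SlabMeasure.
Context {R : realType}.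
Variables (k : conic) (a b : R).
Local Notation prof := (profile k a b).
Local Notation mu := (@lebesgue_measure R).

(** A relaxed parameter region: the ball enters only through the bound on [pole_distance], and the
    slab through the polar form nu (cos t0, sin t0) of the last two coordinates of the normal. *)
Definition focal_slab (rho n1 nu t0 t d : R) : set (R * R) :=
  [set v | (0 <= pole_distance k a v.1 <= rho) /\ (0 <= v.2 < 2 * pi) /\
     t <= n1 * v.1 + prof v.1 * nu * cos (v.2 - t0) <= t + d].

Lemma measurable_focal_slab rho n1 nu t0 t d :
  measurable (focal_slab rho n1 nu t0 t d).
Proof.
pose h (v : R * R) := n1 * v.1 + prof v.1 * nu * cos (v.2 - t0).
have mp : measurable_fun setT (fun v : R * R => pole_distance k a v.1).
  apply: measurable_funM => //; apply: measurable_funB => //.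
  by apply: measurableT_comp => //; exact: measurable_fst.
have mc : measurable_fun setT (@cos R).
  by apply: continuous_measurable_fun; exact: continuous_cos.
have mh : measurable_fun setT h.
  apply: measurable_funD; first by apply: measurable_funM => //; exact: measurable_fst.
  apply: measurable_funM.
    apply: measurable_funM => //.
    by apply: (measurableT_comp (measurable_profile k a b)); exact: measurable_fst.
  by apply: (measurableT_comp mc); apply: measurable_funB.
have -> : focal_slab rho n1 nu t0 t d =
    (fun v : R * R => pole_distance k a v.1) @^-1` `[0, rho]%classic `&`
    (snd @^-1` `[0, 2 * pi[%classic `&` h @^-1` `[t, t + d]%classic).
  by apply/seteqP; split=> v; rewrite /focal_slab /h /= !in_itv.
have pre (f : R * R -> R) (I : interval R) : measurable_fun setT f ->
    measurable (f @^-1` [set` I]).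
  by move=> mf; rewrite -[X in measurable X]setTI; apply: mf => //; exact: measurable_itv.
apply: measurableI; first exact: pre.
by apply: measurableI; apply: pre => //; exact: measurable_snd.
Qed.

(** The product measure integrates the slices at fixed x. The parts x >= 0 and x < 0 use
    [slice_majorant] with si = 1 and si = -1, hence the factor 2. *)
Lemma focal_slab_measure (C c rho w n1 nu t0 t d : R) :
  1 <= C -> 0 < a -> 0 < b -> 0 < rho -> 0 < w -> w ^+ 2 = b ^+ 2 * rho / a ->
  b ^+ 2 <= C * rho * a -> rho <= C * a -> n1 ^+ 2 + nu ^+ 2 = 1 -> 0 <= nu ->
  C^-1 ^+ 5 = 512 * c -> 0 < d -> 0 <= t0 < 2 * pi ->
  ((mu \x mu) (focal_slab rho n1 nu t0 t d)
    <= (2 * ((256 / Num.sqrt c + 64 * C) * (d * rho / w)))%:E)%E.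
Proof.
move=> C1 a0 b0 rho0 w0 wE brho rhoa nE nu0 cE d0 t00.
have [g1 [m1 p1 i1] H1] := slice_majorant C1 a0 b0 rho0 w0 wE brho rhoa nE
  (sqr_conic_sign k) (expr1n _ 2) t cE nu0 d0 t00.
have [g2 [m2 p2 i2] H2] := slice_majorant C1 a0 b0 rho0 w0 wE brho rhoa nE
  (sqr_conic_sign k) (etrans (sqrrN 1) (expr1n _ 2)) t cE nu0 d0 t00.
set K := (_ + _) * _ in i1 i2 *.
have mE := measurable_focal_slab rho n1 nu t0 t d.
apply: (@le_trans _ _ (\int[mu]_x (g1 x + g2 x))%E); last first.
  rewrite ge0_integralD//.
  by apply: (le_trans (leeD i1 i2)); rewrite -EFinD lee_fin; lra.
apply: ge0_le_integral_nonmeasurable => x _; first exact: measure_ge0.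
rewrite /comp; set X := xsection _ _.
have mX : measurable X by exact: measurable_xsection.
have [->|/set0P[u0]] := eqVneq X set0; first by rewrite measure0 adde_ge0.
rewrite /X /xsection /= inE => -[/= yr _].
have /andP[y0 yl] := yr.
have xD := (profile_domainE k a x).2 y0.
have xE := norm_pole_distance k a x.
have ya : - a <= @conic_sign R k * pole_distance k a x.
  by move: (normr_ge0 x); rewrite xE; lra.
have r0 := profile_ge0 k a b0 x.
have HX u : X u -> 0 <= u < 2 * pi /\ t <= n1 * x + prof x * nu * cos (u - t0) <= t + d.
  by rewrite /X /xsection /= inE => -[_ []].
have r2 := sqr_profile_pole b a0 xD.
have [x0|x0] := lerP 0 x.
  have xE1 : x = 1 * (a + @conic_sign R k * pole_distance k a x).
    by rewrite -xE mul1r ger0_norm.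
  apply: (@le_trans _ _ (g1 x)); last by rewrite leeDl.
  rewrite [X in (_ <= g1 X)%E]xE1; apply: (H1 _ _ _ yr ya r0 r2 mX).
  by rewrite -xE1; exact: HX.
have xE1 : x = -1 * (a + @conic_sign R k * pole_distance k a x).
  by rewrite -xE mulN1r ltr0_norm// opprK.
apply: (@le_trans _ _ (g2 x)); last by rewrite leeDr.
rewrite [X in (_ <= g2 X)%E]xE1; apply: (H2 _ _ _ yr ya r0 r2 mX).
by rewrite -xE1; exact: HX.
Qed.

End SlabMeasure.

(** * Assembly of the area estimate *)

Lemma dot_rotate (R : realType) (n : 'rV[R]_3) x r theta :
  dot n (rotate x r theta) =
    n 0 0 * x + r * (n 0 1 * cos theta + n 0 2%:R * sin theta).
Proof.
rewrite /dot !big_ord_recr big_ord0 /= add0r !mxE /= mulrDr !mulrA addrA.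
have -> : widen_ord (leqnSn 2) (widen_ord (leqnSn 1) ord_max) = 0 :> 'I_3 by exact: val_inj.
have -> : widen_ord (leqnSn 2) ord_max = 1 :> 'I_3 by exact: val_inj.
have -> : ord_max = 2%:R :> 'I_3 by exact: val_inj.
ring.
Qed.

(** On these lines the profile is not differentiable and [area_element_le] gives nothing; being
    null, they may carry an infinite majorant. *)
Lemma product_lebesgue_line0 (R : realType) (a : R) :
  ((@lebesgue_measure R) \x (@lebesgue_measure R))%E
    (([set a] `|` [set - a]) `*` [set: R]) = 0%E.
Proof.
have mN (x : R) : measurable [set x] by exact: measurable_set1.
have mu0 : (@lebesgue_measure R) ([set a] `|` [set - a]) = 0%E.
  apply/eqP; rewrite eq_le measure_ge0 andbT.
  have s0 x : (@lebesgue_measure R) [set x] = 0%E := lebesgue_measure_set1 x.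
  apply: (@le_trans _ _ (lebesgue_measure [set a] + lebesgue_measure [set (- a)%R])%E).
    exact: (@measureU2 _ _ _ (@lebesgue_measure R) _ _ (mN _) (mN _)).
  by rewrite !s0 adde0.
rewrite product_measure1E//; last exact: measurableU.
by rewrite [X in (X * _)%E](_ : _ = 0%E) ?mul0e.
Qed.

Theorem theorem2p2 (R : realType) (C0 : R) (hC0 : 1 <= C0) :
  exists2 C : R, 1 <= C &
    forall (k : conic) (a b : R), 0 < b -> b <= a ->
    forall (F : 'rV[R]_3), foci k a b F ->
    forall rho : R, C0^-1 * (b ^+ 2 / a) <= rho -> rho <= C0 * a ->
    forall delta : R, 0 < delta ->
    forall P : set 'rV[R]_3, thickened_plane delta P ->
    (surface_measure k a b (quadric k a b `&` closed_eball F rho `&` P)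
       <= (C * rho * delta)%:E)%E.
Proof.
have C00 : 0 < C0 := lt_le_trans ltr01 hC0.
pose c := C0^-1 ^+ 5 / 512.
have cE : C0^-1 ^+ 5 = 512 * c by rewrite /c; lra.
(* The area element bound 3 C0^2 w times the region bound 2 (256 / sqrt c + 64 C0) delta rho / w;
   the scale w cancels. *)
pose K := 6 * C0 ^+ 2 * (256 / Num.sqrt c + 64 * C0).
exists K.
  have : 1 <= C0 ^+ 2 by rewrite exprn_ege1.
  have : 0 <= 256 / Num.sqrt c by rewrite divr_ge0 ?sqrtr_ge0.
  by rewrite /K; nra.
move=> k a b b0 ba F HF rho rho1 rho2 d d0 P [n [t [n1 ->]]].
have a0 := lt_le_trans b0 ba.
have rho0 : 0 < rho.
  by apply: lt_le_trans rho1; rewrite mulr_gt0 ?invr_gt0// divr_gt0// exprn_gt0.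
have brho : b ^+ 2 <= C0 * rho * a.
  by move: rho1; rewrite ler_pdivrMl// ler_pdivrMr.
pose w := b * Num.sqrt (rho / a).
have w0 : 0 < w by rewrite mulr_gt0// sqrtr_gt0 divr_gt0.
have wE : w ^+ 2 = b ^+ 2 * rho / a.
  by rewrite exprMn sqr_sqrtr ?mulrA// divr_ge0// ltW.
pose nu := Num.sqrt (n 0 1 ^+ 2 + n 0 2%:R ^+ 2).
have nu0 : 0 <= nu := sqrtr_ge0 _.
have nuE : n 0 1 ^+ 2 + n 0 2%:R ^+ 2 = nu ^+ 2.
  by rewrite sqr_sqrtr// addr_ge0 ?sqr_ge0.
have [t0 t00 [n2E n3E]] := polar_coordinates nu0 nuE.
have n1E : n 0 0 ^+ 2 + nu ^+ 2 = 1.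
  have := congr1 (fun x => x ^+ 2) n1.
  rewrite /enorm expr1n sqr_sqrtr => [<-|]; last first.
    by rewrite sumr_ge0// => i _; rewrite -expr2 sqr_ge0.
  rewrite -nuE /dot !big_ord_recr big_ord0 /= add0r -!expr2 addrA.
  by congr (n _ _ ^+ 2 + n _ _ ^+ 2 + n _ _ ^+ 2); exact: val_inj.
pose E := focal_slab k a b rho (n 0 0) nu t0 t d.
have mE : measurable E by exact: measurable_focal_slab.
have muE := @focal_slab_measure R k a b C0 c rho w (n 0 0) nu t0 t d
  hC0 a0 b0 rho0 w0 wE brho rho2 n1E nu0 cE d0 t00.
pose N : set (R * R) := ([set a] `|` [set - a]) `*` [set: R].
have mN : measurable N by apply: measurableX => //; apply: measurableU; exact: measurable_set1.
pose M := 3 * C0 ^+ 2 * w.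
have M0 : 0 <= M by rewrite mulr_ge0 ?(ltW w0)// mulr_ge0 ?sqr_ge0.
rewrite /surface_measure /parametrized_area integral_mkcond.
(* The majorant is the constant M on the relaxed region plus an infinite weight on the null lines
   |x| = a. *)
apply: (@le_trans _ _ (\int[(@lebesgue_measure R) \x (@lebesgue_measure R)]_v
    (M%:E * (\1_E v)%:E + +oo * (\1_N v)%:E))%E).
  apply: ge0_le_integral_nonmeasurable => -[x theta] _; rewrite patchE; case: ifPn => //.
    by move=> _; rewrite lee_fin mulr_ge0// sqrtr_ge0.
  rewrite inE => -[/= xD]; rewrite in_itv /= => th.
  have [xa|xa] := eqVneq `|x| a.
    rewrite (_ : \1_N (x, theta) = 1) ?mule1; last first.
      rewrite indicE mem_set//; split=> //=; have [x0|x0] := lerP 0 x.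
        by left; rewrite -xa ger0_norm.
      by right; rewrite /= -xa ltr0_norm// opprK.
    by rewrite addey ?leey.
  apply: (@le_trans _ _ (M%:E * (\1_E (x, theta))%:E)%E); last first.
    by rewrite leeDl// mule_ge0.
  rewrite -EFinM lee_fin [X in X * area_element _ _ _ <= _]indicE.
  have [|_] := boolP (_ \in _ `&` _); last by rewrite mul0r mulr_ge0.
  rewrite inE => -[[_ HB] HP].
  have yr := pole_distance_le_focal a0 b0 ba HF xD HB.
  rewrite (_ : \1_E (x, theta) = 1).
    rewrite mul1r mulr1.
    exact: (area_element_le hC0 a0 b0 w0 wE brho rho2 theta xD xa yr).
  rewrite indicE mem_set//; split; rewrite /= ?yr ?andbT.
    exact/profile_domainE.
  split=> //; move: HP; rewrite /= dot_rotate n2E n3E.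
  have -> : nu * cos t0 * cos theta + nu * sin t0 * sin theta = nu * cos (theta - t0).
    by rewrite cosB; ring.
  by rewrite mulrA.
  by move=> _; apply: adde_ge0; rewrite mule_ge0.
have mME : measurable_fun setT (fun v : R * R => (M%:E * (\1_E v)%:E)%E).
  by apply: measurable_funeM; apply/measurable_EFinP; exact: measurable_indic.
have mNN : measurable_fun setT (fun v : R * R => (+oo * (\1_N v : R)%:E)%E).
  apply: (@emeasurable_funM _ _ _ _ (cst +oo%E)) => //.
  by apply/measurable_EFinP; exact: measurable_indic.
rewrite ge0_integralD//; last by move=> v _; rewrite mule_ge0.
rewrite !ge0_integralZl//; last 2 first.
- by apply/measurable_EFinP; exact: measurable_indic.
- by apply/measurable_EFinP; exact: measurable_indic.
rewrite !integral_indic// !setIT.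
rewrite [X in (+oo * X)%E](_ : _ = 0%E) ?mule0 ?adde0; last exact: product_lebesgue_line0.
apply: (le_trans (lee_wpmul2l _ muE)); first by rewrite lee_fin.
rewrite -EFinM lee_fin le_eqVlt; apply/orP; left; apply/eqP.
have sc0 : Num.sqrt c != 0.
  by rewrite gt_eqF// sqrtr_gt0; have : 0 < C0^-1 ^+ 5 by [rewrite exprn_gt0// invr_gt0]; lra.
by rewrite /K /M; field; rewrite sc0 gt_eqF.
Qed.
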